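(* For every graph $F$ of diameter $2$, there exist infinitely many pairwise non-isomorphic graphs $G$ of diameter $3$ that are $F$-irregular.
   Context: All graphs are simple, finite, undirected and non-trivial. For graphs $F$ and $G$ and a vertex $v$ of $G$, the $F$-degree of $v$ in $G$ is the number of subgraphs of $G$ (not necessarily induced) that are isomorphic to $F$ and contain $v$. A graph $G$ is $F$-irregular if any two distinct vertices of $G$ have different $F$-degrees. *)

(* Defs.v *)
From mathcomp Require Import all_boot.
Set Implicit Arguments. Unset Strict Implicit. Unset Printing Implicit Defensive.

Record sgraph := SGraph {
  vert : finType;
  adj : rel vert;
  adj_sym : symmetric adj;
  adj_irr : irreflexive adj }.

Definition nontrivial (G : sgraph) : Prop := 1 < #|vert G|.

Definition within (G : sgraph) (k : nat) (u v : vert G) : Prop :=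
  exists p : seq (vert G), [&& path (@adj G) u p, last u p == v & size p <= k].

Definition has_diameter (G : sgraph) (d : nat) : Prop :=
  0 < d /\ (forall u v : vert G, within d u v) /\
  exists u v : vert G, ~ within d.-1 u v.

Definition isomorphic (G H : sgraph) : Prop :=
  exists f : vert G -> vert H, bijective f /\
    forall x y, adj (f x) (f y) = adj x y.

(* A subgraph of G (not necessarily induced) is a pair (S, E) with S a vertex
   set and E a symmetric set of ordered pairs encoding edges of G between
   vertices of S. *)
Definition is_subgraph (G : sgraph) (p : {set vert G} * {set (vert G * vert G)}) : bool :=
  [forall xy in p.2,
     [&& adj xy.1 xy.2, xy.1 \in p.1, xy.2 \in p.1 & (xy.2, xy.1) \in p.2]].

Definition subgraph_iso (F G : sgraph) (p : {set vert G} * {set (vert G * vert G)}) : bool :=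
  [exists f : {ffun vert F -> vert G},
     [&& injectiveb f, f @: setT == p.1 &
         [forall x, forall y, ((f x, f y) \in p.2) == adj x y]]].

Definition Fdeg (F G : sgraph) (v : vert G) : nat :=
  #|[set p : {set vert G} * {set (vert G * vert G)} |
       [&& is_subgraph p, subgraph_iso F p & v \in p.1]]|.

Definition F_irregular (F G : sgraph) : Prop := injective (@Fdeg F G).

(* Main.v *)
Require Import Defs.
From mathcomp Require Import all_boot.
From mathcomp Require Import perm zify.

Set Implicit Arguments. Unset Strict Implicit. Unset Printing Implicit Defensive.

(* Let m = #|F|.  Take two cliques x_0, ..., x_n and y_0, ..., y_n with x_i ~ y_j
   iff i + j > n, and a vertex t adjacent to x_0, ..., x_(m-1), with n huge
   compared to m.  The number of labelled embeddings of F through a vertex is its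
   F-degree times #|Aut F|; it increases along t, y_0, x_0, y_1, x_1, ..., y_n, x_n.
   From y_i to x_i: the flip x_i <-> y_i shows that both lie on equally many
   embeddings avoiding t.  As F has diameter 2, an embedding through t meets only
   x's and the last m - 1 y's, so exchanging y_i and x_i injects those through y_i
   into those through x_i, and it misses some.
   From x_i to y_(i+1): exchanging x_i and x_(i+1), whose neighbourhoods are nested,
   shows that the embeddings avoiding t gain at least those which avoid x_i and use
   the edge x_(i+1) y_(n-i).  The latter outnumber the embeddings through t and x_i:
   all but O(n^(m-3)) of these meet no other vertex among x_0, ..., x_m, so that t
   plays a leaf, and moving the edge t x_i onto y_(n-i) x_(i+1) injects them while
   missing the order of n^(m-2) embeddings in which y_(n-i) does not play a leaf.
   From t to y_0: O(n^(m-2)) embeddings go through t, but the order of n^(m-1) map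
   into the clique of the x's and go through x_0. *)

(** * Counting finite functions *)

Lemma expn_leq_ffact q k n : q + k <= n -> q ^ k <= n ^_ k.
Proof.
elim: k n => // k IH [|n]; rewrite addnS // ltnS => qkn.
by rewrite ffactSS expnS leq_mul ?IH // (leq_trans (leq_addr k q)) // ltnW.
Qed.

Lemma mul_expn_lt_ffact a c q r N k :
  N <= a * q -> c * a ^ r < q -> q + r.+1 <= k -> c * N ^ r < k ^_ r.+1.
Proof.
move=> Naq caq qk.
apply: (@leq_ltn_trans (c * (a * q) ^ r)).
  by case: r {caq qk} => // r; rewrite leq_mul2l leq_exp2r ?Naq ?orbT.
apply: (@leq_trans (q ^ r.+1)).
  by rewrite expnMn mulnA expnS ltn_mul2r caq expn_gt0 (leq_ltn_trans _ caq).
exact: expn_leq_ffact.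
Qed.

Lemma leq_card_disjointU (T : finType) (A B C : {set T}) :
  A \subset C -> B \subset C -> [disjoint A & B] -> #|A| + #|B| <= #|C|.
Proof.
move=> AC BC; case: (leq_card_setU A B) => _ <- /eqP <-.
by rewrite subset_leq_card // subUset AC.
Qed.

Lemma leq_card_bigcup (I T : finType) (A : {set T}) (C : I -> {set T}) k :
  A \subset \bigcup_i C i -> (forall i, #|C i| <= k) -> #|A| <= #|I| * k.
Proof.
move=> /subset_leq_card/leq_trans leA leC; apply: leA.
rewrite -sum_nat_const; elim/big_rec2: _ => [|i s B _ leB]; first by rewrite cards0.
by rewrite (leq_trans (leq_card_setU _ _)) // leq_add.
Qed.

Lemma card_uniform_fibers (aT rT : finType) (h : aT -> rT) (A : {set aT}) k :
  {in A, forall x, #|[set y in A | h y == h x]| = k} -> #|A| = #|h @: A| * k.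
Proof.
move=> fibk; rewrite -sum1_card (partition_big_imset h) /= -sum_nat_const.
by apply: eq_bigr => _ /imsetP [x xA ->]; rewrite -(fibk x xA) sum1dep_card.
Qed.

Section Extensions.

Variables (S T : finType) (D : {set S}) (p : S -> T).

Lemma card_sig_setC : #|{: {e | e \in ~: D}}| = #|S| - #|D|.
Proof. by rewrite card_sig -(cardsC D) addKn; apply: eq_card => e; rewrite !inE. Qed.

Definition extensions : {set {ffun S -> T}} :=
  [set f : {ffun S -> T} | [forall e in D, f e == p e]].

Lemma extensionsP (f : {ffun S -> T}) : reflect {in D, f =1 p} (f \in extensions).
Proof. by rewrite inE; apply: eqfun_inP. Qed.

Definition extend (g : {ffun {e | e \in ~: D} -> T}) : {ffun S -> T} :=
  [ffun e => oapp g (p e) (insub e)].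

Lemma extend_val g e : extend g (val e) = g e.
Proof. by rewrite ffunE valK. Qed.

Lemma extend_extensions g : extend g \in extensions.
Proof. by apply/extensionsP=> e eD; rewrite ffunE insubF //= inE eD. Qed.

Lemma extend_inj : injective extend.
Proof. by move=> g h /ffunP gh; apply/ffunP=> e; rewrite -!extend_val gh. Qed.

Lemma imset_extend : extend @: setT = extensions.
Proof.
apply/setP=> f; apply/imsetP/idP => [[g _ ->]|/extensionsP fp].
  exact: extend_extensions.
exists [ffun e => f (val e)] => //; apply/ffunP=> e; rewrite ffunE.
case: insubP => [e' _ <-|] /=; first by rewrite ffunE.
by rewrite inE negbK => /fp.
Qed.

Lemma card_extensions : #|extensions| = #|T| ^ (#|S| - #|D|).
Proof.
rewrite -imset_extend card_imset; last exact: extend_inj.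
by rewrite cardsT card_ffun card_sig_setC.
Qed.

Definition injective_extensions (K : {set T}) : {set {ffun S -> T}} :=
  [set f in extensions | injectiveb f && (codom f \subset K)].

Lemma injective_extensionsP (K : {set T}) (f : {ffun S -> T}) :
  reflect [/\ {in D, f =1 p}, injective f & forall e, f e \in K]
          (f \in injective_extensions K).
Proof.
rewrite inE; apply: (iffP and3P) => -[/extensionsP fp /injectiveP fI fK]; split=> //.
  by move=> e; apply: (subsetP fK); apply: codom_f.
by apply/subsetP=> _ /codomP [e ->].
Qed.

Lemma leq_card_injective_extensions (K : {set T}) :
  {in D &, injective p} -> {in D, forall e, p e \in K} ->
  (#|K| - #|D|) ^_ (#|S| - #|D|) <= #|injective_extensions K|.
Proof.
move=> pI pK; pose R := K :\: p @: D.
have cardR : #|R| = #|K| - #|D|.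
  rewrite cardsD (setIidPr _) ?card_in_imset //.
  by apply/subsetP=> _ /imsetP [e eD ->]; apply: pK.
rewrite -cardR -card_sig_setC -card_inj_ffuns_on -(card_imset _ extend_inj).
apply/subset_leq_card/subsetP => _ /imsetP [g + ->].
rewrite inE => /andP [/ffun_onP gR /injectiveP gI].
have ext := extensionsP _ (extend_extensions g).
have outD e : e \notin D -> exists e', e = val e' /\ extend g e = g e'.
  move=> eD; have eD' : e \in ~: D by rewrite inE.
  by exists (exist _ e eD'); rewrite -extend_val.
apply/injective_extensionsP; split=> // [e e'|e].
  have [eD|/outD [a [-> ->]]] := boolP (e \in D);
    have [eD'|/outD [a' [-> ->]]] := boolP (e' \in D).
  - by rewrite !ext //; apply: pI.
  - by rewrite ext // => E; have := gR a'; rewrite inE -E imset_f.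
  - by rewrite ext // => E; have := gR a; rewrite inE E imset_f.
  - by move/gI => ->.
have [eD|/outD [a [_ ->]]] := boolP (e \in D); first by rewrite ext // pK.
by have := gR a; rewrite inE => /andP [].
Qed.

End Extensions.

Definition covering (S T : finType) (Z : {set T}) : {set {ffun S -> T}} :=
  [set f : {ffun S -> T} | Z \subset codom f].

Lemma leq_card_covering (S T : finType) (Z : {set T}) :
  #|covering S Z| <= #|S| ^ #|Z| * #|T| ^ (#|S| - #|Z|).
Proof.
pose C (r : {ffun {z | z \in Z} -> S}) : {set {ffun S -> T}} :=
  [set f : {ffun S -> T} | [forall z, f (r z) == val z]].
have -> : #|S| ^ #|Z| = #|{: {ffun {z | z \in Z} -> S}}|.
  by rewrite card_ffun card_sig.
apply: (leq_card_bigcup (C := C)) => [|r].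
  apply/subsetP=> f; rewrite inE => /subsetP Zf; apply/bigcupP.
  exists [ffun z => iinv (Zf (val z) (valP z))] => //; rewrite inE.
  by apply/forallP=> z; rewrite ffunE f_iinv.
have [->|[f0]] := set_0Vmem (C r); first by rewrite cards0.
rewrite inE => /forallP f0r.
have rI : injective r.
  by move=> z z' E; apply: val_inj; rewrite -(eqP (f0r z)) E (eqP (f0r z')).
have cardr : #|r @: setT| = #|Z| by rewrite card_imset // cardsT card_sig.
rewrite -cardr -(card_extensions _ f0); apply/subset_leq_card/subsetP => f.
rewrite inE => /forallP fr; apply/extensionsP=> _ /imsetP [z _ ->].
by rewrite (eqP (fr z)) (eqP (f0r z)).
Qed.

(** * Functions through a point *)

Section Through.

Variables S T : finType.
Implicit Types (f : {ffun S -> T}) (A : {set {ffun S -> T}}).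

Definition through A x : {set {ffun S -> T}} := [set f in A | x \in codom f].
Definition missing A x : {set {ffun S -> T}} := [set f in A | x \notin codom f].

Lemma in_through A x f : (f \in through A x) = (f \in A) && (x \in codom f).
Proof. exact: in_set. Qed.

Lemma in_missing A x f : (f \in missing A x) = (f \in A) && (x \notin codom f).
Proof. exact: in_set. Qed.

Lemma throughC A x y : through (through A x) y = through (through A y) x.
Proof. by apply/setP=> f; rewrite !in_through andbAC. Qed.

Lemma through_missing A x y : through (missing A x) y = missing (through A y) x.
Proof. by apply/setP=> f; rewrite in_through !in_missing in_through andbAC. Qed.

Lemma card_through_missing A x y :
  #|through A y| = #|through (through A x) y| + #|through (missing A x) y|.
Proof.
rewrite throughC through_missing -(cardsID [set f : {ffun S -> T} | x \in codom f]).
by congr (_ + _); apply: eq_card => f; rewrite !inE // andbC.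
Qed.

Lemma missing_neq A x f : f \in missing A x -> forall e, f e != x.
Proof.
by rewrite in_missing => /andP [_ xf] e; apply: contraNneq xf => <-; apply: codom_f.
Qed.

End Through.

Definition ffun_comp (S T U : finType) (h : T -> U) (f : {ffun S -> T}) :
  {ffun S -> U} := [ffun e => h (f e)].

Lemma ffun_comp_inj (S T U : finType) (h : T -> U) :
  injective h -> injective (@ffun_comp S T U h).
Proof.
move=> hI f g /ffunP fg; apply/ffunP=> e; apply: hI.
by have := fg e; rewrite !ffunE.
Qed.

Lemma mem_codom_ffun_comp (S T U : finType) (h : T -> U) (f : {ffun S -> T}) x :
  injective h -> (h x \in codom (ffun_comp h f)) = (x \in codom f).
Proof.
move=> hI; apply/codomP/codomP => -[e].
  by rewrite ffunE => /hI ->; exists e.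
by move=> ->; exists e; rewrite ffunE.
Qed.

Lemma mem_codom_tperm (S T : finType) (x x' : T) (f : {ffun S -> T}) y :
  (y \in codom (ffun_comp (tperm x x') f)) = (tperm x x' y \in codom f).
Proof. by rewrite -{1}(tpermK x x' y) mem_codom_ffun_comp //; apply: perm_inj. Qed.

Lemma card_through_involutive (S T : finType) (h : T -> T)
    (A : {set {ffun S -> T}}) (x : T) :
  involutive h -> {in A, forall f, ffun_comp h f \in A} ->
  #|through A (h x)| = #|through A x|.
Proof.
move=> hK hA; have hI := inv_inj hK.
have leq_h y : #|through A y| <= #|through A (h y)|.
  rewrite -(card_imset _ (ffun_comp_inj (S := S) hI)).
  apply/subset_leq_card/subsetP => _ /imsetP [f + ->].
  by rewrite !in_through mem_codom_ffun_comp // => /andP [/hA -> ->].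
by apply/eqP; rewrite eqn_leq leq_h -{2}(hK x) leq_h.
Qed.

(* Composition with [tperm x x'] injects the functions through [x] alone into the
   functions through [x'] alone, and misses [Q]. *)
Lemma card_through_tperm (S T : finType) (A Q : {set {ffun S -> T}}) (x x' : T) :
  {in missing (through A x) x', forall f, ffun_comp (tperm x x') f \in A} ->
  {in Q, forall f, [/\ f \in missing A x, x' \in codom f &
                       ffun_comp (tperm x x') f \notin A]} ->
  #|through A x| + #|Q| <= #|through A x'|.
Proof.
move=> swA QP; rewrite (card_through_missing A x' x) (card_through_missing A x x').
rewrite throughC -addnA leq_add2l.
rewrite -(card_imset _ (ffun_comp_inj (S := S) (@perm_inj _ (tperm x x')))).
rewrite through_missing; apply: leq_card_disjointU.
- apply/subsetP => _ /imsetP [f fP ->].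
  rewrite in_through in_missing swA // !mem_codom_tperm tpermL tpermR.
  by case/setIdP: fP => /setIdP [_ ->] ->.
- by apply/subsetP => f /QP [fA x'f _]; rewrite in_through fA.
rewrite disjoints_subset; apply/subsetP => _ /imsetP [f + ->].
case/setIdP=> /setIdP [fA _] _; rewrite inE; apply/negP => /QP [_ _ /negP]; apply.
suff -> : ffun_comp (tperm x x') (ffun_comp (tperm x x') f) = f by [].
by apply/ffunP=> e; rewrite !ffunE tpermK.
Qed.

(** * Embeddings and F-degrees *)

Definition embeddings (F G : sgraph) : {set {ffun vert F -> vert G}} :=
  [set f : {ffun vert F -> vert G} |
     injectiveb f && [forall x, forall y, adj x y ==> adj (f x) (f y)]].

Lemma embeddingsP (F G : sgraph) (f : {ffun vert F -> vert G}) :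
  reflect (injective f /\ forall x y, adj x y -> adj (f x) (f y))
          (f \in embeddings F G).
Proof.
rewrite inE; apply: (iffP andP) => [[/injectiveP fI /forallP fE]|[fI fE]].
  by split=> // x y; have /forallP/(_ y)/implyP := fE x.
split; first exact/injectiveP.
by apply/forallP=> x; apply/forallP=> y; apply/implyP/fE.
Qed.

Lemma embedding_inj (F G : sgraph) (f : {ffun vert F -> vert G}) :
  f \in embeddings F G -> injective f.
Proof. by case/embeddingsP. Qed.

Lemma embedding_adj (F G : sgraph) (f : {ffun vert F -> vert G}) x y :
  f \in embeddings F G -> adj x y -> adj (f x) (f y).
Proof. by case/embeddingsP=> _; apply. Qed.

Lemma adj_neq (G : sgraph) (u v : vert G) : adj u v -> u != v.
Proof. by apply: contraTneq => ->; rewrite adj_irr. Qed.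

Definition automorphisms (F : sgraph) : {set {ffun vert F -> vert F}} :=
  [set a : {ffun vert F -> vert F} |
     injectiveb a && [forall x, forall y, adj (a x) (a y) == adj x y]].

Lemma automorphismsP (F : sgraph) (a : {ffun vert F -> vert F}) :
  reflect (injective a /\ forall x y, adj (a x) (a y) = adj x y)
          (a \in automorphisms F).
Proof.
rewrite inE; apply: (iffP andP) => [[/injectiveP aI /forallP aE]|[aI aE]].
  by split=> // x y; have /forallP/(_ y)/eqP := aE x.
split; first exact/injectiveP.
by apply/forallP=> x; apply/forallP=> y; apply/eqP/aE.
Qed.

Section Copies.

Variables F G : sgraph.
Implicit Types (f g : {ffun vert F -> vert G}).
Implicit Types (p : {set vert G} * {set (vert G * vert G)}).

Definition copy f : {set vert G} * {set (vert G * vert G)} :=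
  (f @: setT, [set (f e.1, f e.2) | e in [set e | adj e.1 e.2]]).

Lemma mem_copy_edges f x y : injective f -> ((f x, f y) \in (copy f).2) = adj x y.
Proof.
move=> fI; apply/imsetP/idP => [[[a b]]|xy].
  by rewrite inE /= => ab [/fI -> /fI ->].
by exists (x, y); rewrite ?inE.
Qed.

Lemma is_subgraph_copy f : f \in embeddings F G -> is_subgraph (copy f).
Proof.
move=> fE; apply/forallP=> z; apply/implyP => /imsetP [[x y]].
rewrite inE /= => xy -> /=; rewrite (embedding_adj fE) ?imset_f //=.
by apply/imsetP; exists (y, x); rewrite ?inE //= adj_sym.
Qed.

Lemma copy_eq f p : is_subgraph p -> f @: setT = p.1 ->
  (forall x y, ((f x, f y) \in p.2) = adj x y) -> copy f = p.
Proof.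
case: p => V E /forallP sub /= fV fE; rewrite /copy fV; congr (_, _).
apply/setP=> -[u v]; apply/imsetP/idP => [[[x y]]|uvE].
  by rewrite inE /= -fE => ? [-> ->].
have := sub (u, v); rewrite uvE /= -fV => /and4P [_].
move=> /imsetP [x _ xu] /imsetP [y _ yv] _; exists (x, y); last by rewrite xu yv.
by rewrite inE /= -fE -xu -yv.
Qed.

Lemma copyP p : reflect (exists2 f, f \in embeddings F G & p = copy f)
                        (is_subgraph p && subgraph_iso F p).
Proof.
apply: (iffP andP) => [[sub /existsP [f /and3P [/injectiveP fI /eqP fV fE]]]|].
  have {}fE x y : ((f x, f y) \in p.2) = adj x y.
    by have /forallP/(_ x)/forallP/(_ y)/eqP := fE.
  exists f; last by rewrite (copy_eq sub fV fE).
  apply/embeddingsP; split=> // x y; rewrite -fE => xyE.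
  by have /forallP/(_ (f x, f y)) := sub; rewrite xyE => /andP [].
case=> f fE ->; split; first exact: is_subgraph_copy.
have fI := embedding_inj fE.
apply/existsP; exists f; apply/and3P; split=> //; first exact/injectiveP.
by apply/forallP=> x; apply/forallP=> y; rewrite mem_copy_edges.
Qed.

Lemma Fdeg_copies v : Fdeg F v = #|copy @: through (embeddings F G) v|.
Proof.
apply: eq_card => p; rewrite inE andbA; apply/andP/imsetP => [[/copyP [f fE ->]]|].
  case/imsetP=> e _ ->; exists f => //.
  by rewrite in_through fE codom_f.
case=> f; rewrite in_through => /andP [fE /codomP [e ->]] ->.
by split; [apply/copyP; exists f | apply: imset_f].
Qed.

Lemma card_copy_fiber f : f \in embeddings F G ->
  #|[set g in embeddings F G | copy g == copy f]| = #|automorphisms F|.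
Proof.
move=> fE; have fI := embedding_inj fE.
rewrite -(card_imset _ (ffun_comp_inj (S := vert F) fI)).
apply: eq_card => g; rewrite inE; apply/andP/imsetP => [[gE /eqP gf]|[a]].
  have gf_edges x y : ((g x, g y) \in (copy f).2) = adj x y.
    by rewrite -gf mem_copy_edges //; apply: embedding_inj gE.
  have fg x : g x \in codom f.
    have: g x \in (copy g).1 by apply: imset_f.
    by rewrite gf => /imsetP [y _ ->]; apply: codom_f.
  exists [ffun x => iinv (fg x)]; last by apply/ffunP=> x; rewrite !ffunE f_iinv.
  apply/automorphismsP; split=> [x y|x y]; rewrite !ffunE.
    by move/(congr1 f); rewrite !f_iinv => /(embedding_inj gE).
  by rewrite -(mem_copy_edges _ _ fI) !f_iinv.
case/automorphismsP=> aI aE ->; split.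
  apply/embeddingsP; split=> x y; rewrite !ffunE; first by move/fI/aI.
  by rewrite -aE; apply: embedding_adj.
apply/eqP/copy_eq => [||x y]; first exact: is_subgraph_copy.
  apply/setP=> z; apply/imsetP/imsetP => -[x _ ->].
    by exists (a x); rewrite ?ffunE.
  by exists (invF aI x); rewrite // ffunE f_invF.
by rewrite !ffunE mem_copy_edges.
Qed.

Lemma card_through_embeddings v :
  #|through (embeddings F G) v| = Fdeg F v * #|automorphisms F|.
Proof.
rewrite Fdeg_copies; apply: card_uniform_fibers => f.
rewrite in_through => /andP [fE vf]; rewrite -(card_copy_fiber fE).
apply: eq_card => g; rewrite !inE -andbA; congr (_ && _).
rewrite andb_idl // => /eqP/(congr1 fst) /= gf; case/codomP: vf => e ->.
have: f e \in g @: setT by rewrite gf imset_f.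
by case/imsetP=> x _ ->; apply: codom_f.
Qed.

Lemma F_irregular_embeddings :
  injective (fun v => #|through (embeddings F G) v|) -> F_irregular F G.
Proof. by move=> cI u v uv; apply: cI; rewrite /= !card_through_embeddings uv. Qed.

Lemma embeddings_tperm f (x x' : vert G) :
  f \in missing (embeddings F G) x' ->
  (forall e, adj x (f e) -> adj x' (f e)) ->
  ffun_comp (tperm x x') f \in embeddings F G.
Proof.
move=> fP xx'; have nx' := missing_neq fP.
move: fP; rewrite in_missing => /andP [/embeddingsP [fI fE] _].
apply/embeddingsP; split; first by move=> e e'; rewrite !ffunE => /perm_inj /fI.
move=> e e' ee'; rewrite !ffunE.
case: tpermP => [fe|/eqP|_ _]; rewrite ?(negPf (nx' _)) //;
  case: tpermP => [fe'|/eqP|_ _]; rewrite ?(negPf (nx' _)) //.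
- by move: (fE _ _ ee'); rewrite fe fe' adj_irr.
- by apply: xx'; rewrite -fe fE.
- by rewrite adj_sym; apply: xx'; rewrite -fe' fE // adj_sym.
- exact: fE.
Qed.

Definition clique (K : {set vert G}) : Prop :=
  {in K &, forall u v, u != v -> adj u v}.

Lemma injective_extensions_clique (D : {set vert F}) (r : vert F -> vert G) K f :
  clique K -> f \in injective_extensions D r K -> f \in embeddings F G.
Proof.
move=> cK /injective_extensionsP [_ fI fK]; apply/embeddingsP; split=> // x y xy.
by apply: cK; rewrite ?(inj_eq fI) ?adj_neq.
Qed.

End Copies.

(** * Distances *)

Lemma within_refl (G : sgraph) k (u : vert G) : within k u u.
Proof. by exists [::]; rewrite /= eqxx. Qed.

Lemma within_step (G : sgraph) k (w u v : vert G) :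
  u = w \/ adj u w -> within k w v -> within k.+1 u v.
Proof.
case=> [->|uw] [p /and3P [pP pL pS]]; [exists p | exists (w :: p)].
  by rewrite pP pL (leq_trans pS).
by rewrite /= uw pP pL ltnS pS.
Qed.

Lemma within_sym (G : sgraph) k (u v : vert G) : within k u v -> within k v u.
Proof.
case=> p /and3P [pP /eqP pL pS]; exists (rev (belast u p)).
rewrite size_rev size_belast pS andbT -pL rev_path.
rewrite (eq_path (e' := @adj G)) ?pP /=; last by move=> x y; rewrite adj_sym.
by case: p {pP pL pS} => //= a p; rewrite rev_cons last_rcons.
Qed.

Lemma within1P (G : sgraph) (u v : vert G) : within 1 u v <-> u = v \/ adj u v.
Proof.
split=> [[[|w [|w' p]] /and3P []]|uv].
- by move=> _ /eqP; left.
- by rewrite /= andbT => uw /eqP <- _; right.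
- by move=> /= _ _.
- exact: within_step uv (within_refl _ _).
Qed.

Lemma within2P (G : sgraph) (u v : vert G) :
  within 2 u v -> [\/ u = v, adj u v | exists2 w, adj u w & adj w v].
Proof.
case=> [[|w [|w' [|w'' p]]] /and3P []].
- by move=> _ /eqP; constructor 1.
- by rewrite /= andbT => uw /eqP <- _; constructor 2.
- by rewrite /= andbT => /andP [uw ww'] /eqP <- _; constructor 3; exists w.
- by move=> /= _ _.
Qed.

Section Diameter2.

Variable F : sgraph.
Hypothesis diamF : has_diameter F 2.

Lemma diameter2P (u v : vert F) :
  [\/ u = v, adj u v | exists2 w, adj u w & adj w v].
Proof. by apply: within2P; case: diamF => _ []. Qed.

Lemma diameter2_cherry :
  exists v u w : vert F, [/\ v != w, ~~ adj v w, adj v u & adj u w].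
Proof.
case: diamF => _ [_ [v [w nvw]]]; have {}nvw := contra_not (within1P v w).2 nvw.
have vw : v != w by apply/eqP => vw; apply: nvw; left.
have nadj : ~~ adj v w by apply/negP => vw'; apply: nvw; right.
case: (diameter2P v w) => [/eqP|/(negP nadj) //|[u vu uw]]; last by exists v, u, w.
by rewrite (negPf vw).
Qed.

Lemma diameter2_neighbour (u : vert F) : exists v, adj u v.
Proof.
have [v [w [_ [_ _ vw _]]]] := diameter2_cherry.
by case: (diameter2P u v) => [->|uv|[z uz _]]; [exists w | exists v | exists z].
Qed.

Lemma diameter2_card : 2 < #|vert F|.
Proof.
have [v [u [w [vw _ vu uw]]]] := diameter2_cherry.
have <- : #|u |: [set v; w]| = 3.
  by rewrite cardsU1 cards2 vw !inE negb_or (adj_neq uw) eq_sym (adj_neq vu).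
exact: max_card.
Qed.

End Diameter2.

(** * The tagged half graph *)

(* With [x_i = Some (false, i)], [y_i = Some (true, i)] and [t = None]: two cliques
   x_0, ..., x_n and y_0, ..., y_n joined by x_i ~ y_j iff i + j > n, and a vertex
   t adjacent to x_0, ..., x_(m-1). *)
Definition tagged_half_adj (m n : nat) (z z' : option (bool * 'I_n.+1)) : bool :=
  match z, z' with
  | None, None => false
  | None, Some (b, i) | Some (b, i), None => ~~ b && (i < m)
  | Some (b, i), Some (c, j) => if b == c then i != j else n < i + j
  end.

Lemma tagged_half_adj_sym m n : symmetric (@tagged_half_adj m n).
Proof.
by case=> [[b i]|] [[c j]|] //=; rewrite [c == b]eq_sym [j == i]eq_sym [j + i]addnC.
Qed.

Lemma tagged_half_adj_irr m n : irreflexive (@tagged_half_adj m n).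
Proof. by case=> [[b i]|] //=; rewrite !eqxx. Qed.

Definition tagged_half_graph (m n : nat) : sgraph :=
  SGraph (@tagged_half_adj_sym m n) (@tagged_half_adj_irr m n).

Lemma card_tagged_half_graph m n : #|vert (tagged_half_graph m n)| = (2 * n.+1).+1.
Proof. by rewrite card_option card_prod card_bool card_ord. Qed.

Lemma tagged_half_graph_iso m n n' :
  isomorphic (tagged_half_graph m n) (tagged_half_graph m n') -> n = n'.
Proof.
by case=> f [/bij_eq_card]; rewrite !card_tagged_half_graph; lia.
Qed.

Section TaggedHalfGraph.

Variables m n : nat.
Let G := tagged_half_graph m n.
Local Notation X i := (Some (false, i) : vert (tagged_half_graph m n)).
Local Notation Y i := (Some (true, i) : vert (tagged_half_graph m n)).
Local Notation t := (None : vert (tagged_half_graph m n)).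

Lemma tagged_half_graph_diameter : 1 < m -> 0 < n -> has_diameter G 3.
Proof.
move=> m1 n0; pose one : 'I_n.+1 := inord 1.
have oneE : one = 1 :> nat by rewrite inordK.
have side b (i j : 'I_n.+1) :
    (Some (b, i) : vert G) = Some (b, j) \/ @adj G (Some (b, i)) (Some (b, j)).
  by rewrite /= eqxx; case: eqVneq => [->|]; [left | right].
have withinW k (u v : vert G) : u = v \/ adj u v -> within k.+1 u v.
  by move=> uv; apply: within_step uv (within_refl _ _).
have t_near (v : vert G) : within 3 t v.
  case: v => [[[] j]|]; last exact: within_refl.
    apply: (@within_step G _ (X one)); first by right; rewrite /= oneE.
    apply: (@within_step G _ (Y ord_max)); last exact/withinW/side.
    by right; rewrite /= oneE.
  apply: (@within_step G _ (X ord0)); first by right; apply: ltnW.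
  exact/withinW/side.
have X_near_Y (i j : 'I_n.+1) : within 3 (X i) (Y j).
  apply: (@within_step G _ (X ord_max)) => //.
  apply: (@within_step G _ (Y ord_max)); last exact/withinW/side.
  by right; rewrite /= -[n in n < _]addn0 ltn_add2l.
split=> //; split=> [[[b i]|] [[c j]|]|].
- case: b c => [] []; [exact/withinW/side | exact/within_sym | by [] |].
  exact/withinW/side.
- exact/within_sym.
- by [].
- by [].
exists (X ord0), (Y ord0) => /= /within2P [//|/=|[w]]; first by rewrite addn0.
by case: w => [[[] k]|] //=; have := ltn_ord k; lia.
Qed.

Lemma adj_t (z : vert G) : adj t z -> exists2 s : 'I_n.+1, s < m & z = X s.
Proof. by case: z => [[[] s]|] //= sm; exists s. Qed.

Lemma adj_X_succ (i i' : 'I_n.+1) (z : vert G) : i' = i.+1 :> nat ->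
  z != t -> z != X i' -> adj (X i) z -> adj (X i') z.
Proof.
case: z => [[[] k]|] //= i'E _; first by rewrite i'E; lia.
by move=> + _; apply: contra_neq => ->.
Qed.

(* The maximal clique [x_i, ..., x_n, y_(n-i+1), ..., y_n]. *)
Definition ladder (i : nat) : {set vert G} :=
  [set (Some (l < i, if l < i then rev_ord l else l) : vert G) | l : 'I_n.+1].

Lemma card_ladder i : #|ladder i| = n.+1.
Proof.
rewrite card_imset ?card_ord // => k l [] ->.
by case: ifP => // _; apply: rev_ord_inj.
Qed.

Lemma clique_ladder i : clique (ladder i).
Proof.
move=> _ _ /imsetP [k _ ->] /imsetP [l _ ->].
have := ltn_ord k; have := ltn_ord l.
case: (ltnP k i) => ki; case: (ltnP l i) => li /= ln kn; [|lia|lia|].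
  by apply: contra_neq => ->.
by apply: contra_neq => ->.
Qed.

Lemma mem_ladder_X i (l : 'I_n.+1) : (X l \in ladder i) = (i <= l).
Proof.
apply/imsetP/idP => [[k _]|il]; first by case: ltnP => // ki [->].
by exists l; rewrite // ltnNge il.
Qed.

Lemma mem_ladder_rev_Y i (l : 'I_n.+1) : (Y (rev_ord l) \in ladder i) = (l < i).
Proof.
apply/imsetP/idP => [[k _]|li]; last by exists l; rewrite ?li.
by case: ltnP => // ki [E]; have := ltn_ord l; have := ltn_ord k; lia.
Qed.

Lemma t_notin_ladder i : t \notin ladder i.
Proof. by apply/imsetP => -[]. Qed.

Definition flip (z : vert G) : vert G :=
  if z is Some (b, i) then Some (~~ b, i) else None.

Lemma flipK : involutive flip.
Proof. by case=> [[b i]|] //=; rewrite negbK. Qed.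

Lemma adj_flip (z z' : vert G) :
  z != t -> z' != t -> adj (flip z) (flip z') = adj z z'.
Proof. by case: z => [[[] i]|] //; case: z' => [[[] j]|]. Qed.

End TaggedHalfGraph.

(** * Embeddings avoiding t *)

Section Embeddings.

Variables (F : sgraph) (n : nat).
Hypothesis diamF : has_diameter F 2.

Local Notation m := #|vert F|.
Let G := tagged_half_graph m n.
Local Notation X i := (Some (false, i) : vert (tagged_half_graph m n)).
Local Notation Y i := (Some (true, i) : vert (tagged_half_graph m n)).
Local Notation t := (None : vert (tagged_half_graph m n)).
Local Notation N := #|vert (tagged_half_graph m n)|.

Local Notation E := (embeddings F G).
Local Notation avoiding_t := (missing E t).
Local Notation through_t := (through E t).
Implicit Types (f : {ffun vert F -> vert G}) (i j s : 'I_n.+1).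

Lemma flip_avoiding_t f :
  f \in avoiding_t -> ffun_comp (@flip m n) f \in avoiding_t.
Proof.
move=> fP; have ft := missing_neq fP; have flipI := inv_inj (@flipK m n).
move: fP; rewrite !in_missing -[t]/(flip t) mem_codom_ffun_comp //.
case/andP=> /embeddingsP [fI fE] ->; rewrite andbT.
apply/embeddingsP; split=> [e e'|e e' ee']; rewrite !ffunE.
  by move/flipI/fI.
by rewrite adj_flip // fE.
Qed.

Lemma card_avoiding_t_YX i :
  #|through avoiding_t (Y i)| = #|through avoiding_t (X i)|.
Proof. exact: (card_through_involutive (X i) (@flipK m n) flip_avoiding_t). Qed.

(* The edge x_(i+1) y_(n-i) is the one that [tperm (X i) (X i')] breaks. *)
Definition bridging i i' : {set {ffun vert F -> vert G}} :=
  [set f in missing avoiding_t (X i) |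
     [exists a, exists b, [&& adj a b, f a == Y (rev_ord i) & f b == X i']]].

Lemma bridgingP i i' f :
  reflect (f \in missing avoiding_t (X i) /\
           exists a b, [/\ adj a b, f a = Y (rev_ord i) & f b = X i'])
          (f \in bridging i i').
Proof.
apply: (iffP setIdP) => -[fP].
  case/existsP=> a /existsP [b /and3P [ab /eqP fa /eqP fb]].
  by split=> //; exists a, b.
case=> a [b [ab fa fb]]; split=> //.
by apply/existsP; exists a; apply/existsP; exists b; rewrite ab fa fb !eqxx.
Qed.

Lemma card_avoiding_t_step i i' : i' = i.+1 :> nat ->
  #|through avoiding_t (X i)| + #|bridging i i'| <= #|through avoiding_t (X i')|.
Proof.
move=> i'E; apply: card_through_tperm => f.
  case/setIdP=> /setIdP [fP _] fi'; have ft := missing_neq fP.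
  case/setIdP: fP => fE tf; rewrite in_missing.
  rewrite mem_codom_tperm tpermD // tf andbT.
  have fP : f \in missing E (X i') by rewrite in_missing fE.
  apply: embeddings_tperm => // e; apply: adj_X_succ => //.
  exact: missing_neq fP e.
case/bridgingP=> fP [a [b [ab fa fb]]]; split=> //; first by rewrite -fb codom_f.
rewrite in_missing; apply/nandP; left; apply/negP => /embedding_adj /(_ ab).
by rewrite !ffunE fa fb tpermR tpermD //= subSS; have := ltn_ord i; lia.
Qed.

Lemma ladder_avoiding_t (D : {set vert F}) (p : vert F -> vert G) k f :
  f \in injective_extensions D p (ladder m n k) -> f \in avoiding_t.
Proof.
move=> fP; have fE := injective_extensions_clique (@clique_ladder m n k) fP.
rewrite in_missing fE; case/injective_extensionsP: fP => _ _ fK.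
by apply/codomP => -[e te]; have := t_notin_ladder m n k; rewrite te fK.
Qed.

Lemma leq_card_avoiding_t_X0 : n ^_ (m - 1) <= #|through avoiding_t (X ord0)|.
Proof.
have [v _] := diameter2_cherry diamF.
have := @leq_card_injective_extensions _ _ [set v] (fun=> X ord0) (ladder m n 0).
rewrite card_ladder cards1 subn1 => /(_ _ _)/leq_trans; apply.
- by move=> e e' /set1P -> /set1P ->.
- by move=> e _; rewrite mem_ladder_X.
apply/subset_leq_card/subsetP => f fK.
rewrite in_through (ladder_avoiding_t fK) /=.
by case/injective_extensionsP: fK => fp _ _; rewrite -(fp v) ?codom_f // inE.
Qed.

(** * Embeddings through t *)

Lemma t_neighbour f a c : f \in E -> f a = t -> adj a c ->
  exists2 s : 'I_n.+1, s < m & f c = X s.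
Proof. by move=> fE fa /(embedding_adj fE); rewrite fa => /adj_t. Qed.

Lemma leq_card_through_t : #|through_t| <= m * (m ^ 2 * N ^ (m - 2)).
Proof.
have cardZ s : #|[set t; X s]| = 2 by rewrite cards2.
pose C (s : 'I_m) := covering (vert F) [set t; X (inord s)].
rewrite -[Z in _ <= Z * _]card_ord; apply: (leq_card_bigcup (C := C)) => [|s].
  apply/subsetP=> f /setIdP [fE tf]; case/codomP: (tf) => a /esym fa.
  have [c ac] := diameter2_neighbour diamF a; have [s sm fc] := t_neighbour fE fa ac.
  apply/bigcupP; exists (Ordinal sm) => //; rewrite inE inord_val.
  by apply/subsetP=> z /set2P [] -> //; rewrite -fc codom_f.
by rewrite -!(cardZ (inord s)) leq_card_covering.
Qed.

(* In such an embedding t plays a leaf attached to the role of x_i. *)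
Definition lone i : {set {ffun vert F -> vert G}} :=
  [set f in through through_t (X i) |
     [forall s : 'I_n.+1, (s <= m) && (X s \in codom f) ==> (s == i)]].

Lemma leq_card_through_t_X i :
  #|through through_t (X i)| <= #|lone i| + m.+1 * (m ^ 3 * N ^ (m - 3)).
Proof.
have cardZ s : s != i -> #|[set t; X i; X s]| = 3.
  by move=> si; rewrite setUC cardsU1 cards2 !inE /= -[_ == _]/(s == i) si.
rewrite -(cardsID (lone i)) leq_add ?subset_leq_card ?subsetIr //.
pose C (s : 'I_m.+1) : {set {ffun vert F -> vert G}} :=
  if inord s == i then set0 else covering _ [set t; X i; X (inord s)].
rewrite -[Z in _ <= Z * _]card_ord.
apply: (leq_card_bigcup (C := C)) => [|s]; rewrite /C.
  apply/subsetP=> f /setDP [fP]; rewrite inE fP /= => /forallPn [s].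
  rewrite negb_imply -andbA => /and3P [sm sf si].
  apply/bigcupP; exists (Ordinal (sm : s < m.+1)) => //.
  case/setIdP: fP => /setIdP [_ tf] xf; rewrite inord_val (negPf si) inE.
  by apply/subsetP=> z /setUP [/set2P [] ->|/set1P ->].
case: eqVneq => [_|si]; first by rewrite cards0.
by rewrite -!(cardZ _ si) leq_card_covering.
Qed.

Lemma lone_leaf i f : f \in lone i -> exists a b,
  [/\ f a = t, f b = X i, adj a b & forall c, adj a c -> c = b].
Proof.
case/setIdP=> /setIdP [/setIdP [fE /codomP [a /esym fa]] /codomP [b /esym fb]].
move/forallP=> lone_i; exists a, b.
have leaf c : adj a c -> c = b.
  move=> ac; have [s sm fc] := t_neighbour fE fa ac.
  have := lone_i s; rewrite (ltnW sm) -fc codom_f /= => /eqP si.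
  by apply: (embedding_inj fE); rewrite fc fb si.
by split=> //; have [c ac] := diameter2_neighbour diamF a; rewrite -(leaf c ac).
Qed.

Lemma lone_misses i i' f : i' = i.+1 :> nat -> f \in lone i ->
  X i' \notin codom f /\ Y (rev_ord i) \notin codom f.
Proof.
move=> i'E fl; have [a [b [fa fb ab leaf]]] := lone_leaf fl.
case/setIdP: fl => /setIdP [/setIdP [fE _] _] /forallP lone_i.
have im : i < m by have := embedding_adj fE ab; rewrite fa fb.
split.
  apply/negP => i'f; have := lone_i i'; rewrite i'f i'E im => /eqP ii'.
  by move: i'E; rewrite ii'; lia.
apply/codomP => -[e /esym fe].
case: (diameter2P diamF a e) => [ae|/leaf eb|[c /leaf -> be]].
- by rewrite -ae fa in fe.
- by rewrite eb fb in fe.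
- by have := embedding_adj fE be; rewrite fb fe /= subSS; have := ltn_ord i; lia.
Qed.

(* Moves the edge t x_i of an embedding in [lone i] onto y_(n-i) x_(i+1). *)
Definition move_edge i i' (z : vert G) : vert G :=
  tperm (X i) (X i') (tperm t (Y (rev_ord i)) z).

Lemma move_edge_inj i i' : injective (move_edge i i').
Proof. by move=> z z' /perm_inj /perm_inj. Qed.

Lemma move_edge_t i i' : move_edge i i' t = Y (rev_ord i).
Proof. by rewrite /move_edge tpermL tpermD. Qed.

Lemma move_edge_X i i' : move_edge i i' (X i) = X i'.
Proof. by rewrite /move_edge [tperm t _ _]tpermD // tpermL. Qed.

Lemma move_edge_Y i i' : move_edge i i' (Y (rev_ord i)) = t.
Proof. by rewrite /move_edge tpermR tpermD. Qed.

Lemma move_edge_X_succ i i' : move_edge i i' (X i') = X i.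
Proof. by rewrite /move_edge [tperm t _ _]tpermD // tpermR. Qed.

Lemma embeddings_move_edge i i' f : i' = i.+1 :> nat -> f \in lone i ->
  ffun_comp (move_edge i i') f \in E.
Proof.
move=> i'E fl; have [a [b [fa fb ab leaf]]] := lone_leaf fl.
have [i'f yf] := lone_misses i'E fl.
have fE : f \in E by case/setIdP: fl => /setIdP [/setIdP []].
have fI := embedding_inj fE.
have fix_rest e : e != a -> e != b -> move_edge i i' (f e) = f e.
  move=> ea eb; have ef : f e \in codom f := codom_f f e.
  rewrite /move_edge [tperm t _ _]tpermD ?tpermD // ?[_ == f e]eq_sym.
  - by rewrite -fb (inj_eq fI).
  - by apply: contraNneq i'f => <-.
  - by rewrite -fa (inj_eq fI).
  - by apply: contraNneq yf => <-.
have adj_b e :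
    e != a -> adj b e -> adj (move_edge i i' (f b)) (move_edge i i' (f e)).
  move=> ea be; rewrite fb move_edge_X fix_rest // 1?eq_sym ?adj_neq //.
  apply: (adj_X_succ i'E); rewrite -?fb ?(embedding_adj fE) //.
    by rewrite -fa (inj_eq fI).
  by apply: contraNneq i'f => <-; apply: codom_f.
have adj_ab : adj (move_edge i i' (f a)) (move_edge i i' (f b)).
  by rewrite fa fb move_edge_t move_edge_X /= subSS i'E; have := ltn_ord i; lia.
apply/embeddingsP; split=> [e e'|e e' ee']; rewrite !ffunE.
  by move/move_edge_inj/fI.
have [ea|ea] := eqVneq e a; first by move: ee'; rewrite ea => /leaf ->.
have [e'a|e'a] := eqVneq e' a.
  by move: ee'; rewrite e'a adj_sym => /leaf ->; rewrite adj_sym.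
have [eb|eb] := eqVneq e b; first by rewrite eb adj_b // -eb.
have [e'b|e'b] := eqVneq e' b; first by rewrite e'b adj_sym adj_b // -e'b adj_sym.
by rewrite !fix_rest ?(embedding_adj fE).
Qed.

Lemma bridging_move_edge i i' f : i' = i.+1 :> nat -> f \in lone i ->
  ffun_comp (move_edge i i') f \in bridging i i'.
Proof.
move=> i'E fl; have [a [b [fa fb ab _]]] := lone_leaf fl.
have [i'f yf] := lone_misses i'E fl.
apply/bridgingP; split; last first.
  by exists a, b; rewrite !ffunE fa fb move_edge_t move_edge_X.
rewrite !in_missing embeddings_move_edge //=.
rewrite -[t](move_edge_Y i i') -[in X i \notin _](move_edge_X_succ i i').
by rewrite !(mem_codom_ffun_comp _ _ (@move_edge_inj i i')) yf.
Qed.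

Definition edge_pinned (u v : vert F) i i' : {set {ffun vert F -> vert G}} :=
  injective_extensions [set u; v]
    (fun e => if e == u then Y (rev_ord i) else X i') (ladder m n i').

Lemma edge_pinnedP u v i i' f : u != v -> f \in edge_pinned u v i i' ->
  [/\ f u = Y (rev_ord i), f v = X i', injective f &
      forall e, f e \in ladder m n i'].
Proof.
move=> uv /injective_extensionsP [fp fI fK]; split=> //.
  by rewrite fp ?inE ?eqxx.
by rewrite fp ?inE ?eqxx ?orbT // eq_sym (negPf uv).
Qed.

Lemma leq_card_edge_pinned u v i i' : u != v -> i' = i.+1 :> nat ->
  (n - 1) ^_ (m - 2) <= #|edge_pinned u v i i'|.
Proof.
move=> uv i'E; have vu : (v == u) = false by rewrite eq_sym (negPf uv).
pose p e := if e == u then Y (rev_ord i) else X i'.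
have := @leq_card_injective_extensions _ _ [set u; v] p (ladder m n i').
rewrite card_ladder cards2 uv subSS; apply=> [e e'|e].
  by move=> /set2P [] -> /set2P [] ->; rewrite /p ?eqxx ?vu.
case/set2P=> ->; first by rewrite /p eqxx mem_ladder_rev_Y i'E.
by rewrite /p vu mem_ladder_X.
Qed.

Lemma bridging_edge_pinned u v i i' f : adj u v -> i' = i.+1 :> nat ->
  f \in edge_pinned u v i i' -> f \in bridging i i'.
Proof.
move=> uv i'E fP; have [fu fv _ fK] := edge_pinnedP (adj_neq uv) fP.
apply/bridgingP; split; last by exists u, v.
rewrite in_missing (ladder_avoiding_t fP); apply/codomP => -[e fe].
by have := mem_ladder_X m i' i; rewrite fe fK i'E ltnn.
Qed.

(* In the moved embeddings y_(n-i) plays a leaf, in the pinned ones the centre of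
   a cherry. *)
Lemma leq_card_bridging i i' : i' = i.+1 :> nat ->
  #|lone i| + (n - 1) ^_ (m - 2) <= #|bridging i i'|.
Proof.
move=> i'E; have [v [u [w [vw _ vu uw]]]] := diameter2_cherry diamF.
rewrite adj_sym in vu; have uv := adj_neq vu.
apply: leq_trans (leq_add (leqnn _) (leq_card_edge_pinned uv i'E)) _.
rewrite -(card_imset _ (ffun_comp_inj (S := vert F) (@move_edge_inj i i'))).
apply: leq_card_disjointU.
- by apply/subsetP=> _ /imsetP [f fl ->]; apply: bridging_move_edge.
- by apply/subsetP=> f; apply: bridging_edge_pinned.
rewrite disjoints_subset; apply/subsetP=> _ /imsetP [f fl ->]; rewrite inE.
apply/negP => /(edge_pinnedP uv) [fu _ fI _].
have [a [b [fa _ _ leaf]]] := lone_leaf fl.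
have ua : u = a by apply: fI; rewrite fu ffunE fa move_edge_t.
by move: vw; rewrite (leaf v) -?ua // (leaf w) -?ua // eqxx.
Qed.

(* As [F] has diameter 2, an embedding through t stays within distance 2 of t. *)
Lemma through_t_Y_high f e j : f \in through_t -> f e = Y j -> n.+1 < j + m.
Proof.
case/setIdP=> fE /codomP [a /esym fa] fe.
case: (diameter2P diamF a e) => [ae|ae|[c ac ce]].
- by rewrite -ae fa in fe.
- by have := embedding_adj fE ae; rewrite fa fe.
- have [s sm fc] := t_neighbour fE fa ac.
  have : n < s + j by have := embedding_adj fE ce; rewrite fc fe.
  by lia.
Qed.

Definition near_t i : {set vert G} := [set t; X i] :|: [set z | adj t z].

Lemma near_tP i z : z \in near_t i -> z != t -> exists s, z = X s.
Proof.
rewrite !inE -orbA => /or3P [-> // | /eqP -> _ | /adj_t [s _ ->] _].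
  by exists i.
by exists s.
Qed.

Lemma leq_card_near_t i : m <= n.+1 -> m <= #|near_t i|.
Proof.
move=> mn; have XI : injective (fun k : 'I_m => X (widen_ord mn k)).
  by move=> k l [kl]; apply: val_inj.
rewrite -[leqLHS]card_ord -(card_imset _ XI).
apply/subset_leq_card/subsetP => _ /imsetP [k _ ->].
by rewrite !inE /= ltn_ord !orbT.
Qed.

Lemma embeddings_near_t i (v w : vert F) f : ~~ adj v w -> injective f ->
  f v = t -> f w = X i -> (forall e, f e \in near_t i) -> f \in E.
Proof.
move=> nvw fI fv fw fK; apply/embeddingsP; split=> // e e' ee'.
have adj_v c : adj v c -> adj (f v) (f c).
  move=> vc; have := fK c; rewrite !inE -orbA -{1}fv -fw !(inj_eq fI).
  rewrite eq_sym (negPf (adj_neq vc)) -fv /=.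
  by case/orP => // /eqP cw; rewrite cw (negPf nvw) in vc.
have [ev|ev] := eqVneq e v; first by rewrite ev adj_v // -ev.
have [e'v|e'v] := eqVneq e' v; first by rewrite e'v adj_sym adj_v // -e'v adj_sym.
have [|s fe] := near_tP (fK e); first by rewrite -fv (inj_eq fI).
have [|s' fe'] := near_tP (fK e'); first by rewrite -fv (inj_eq fI).
have := adj_neq ee'; rewrite -(inj_eq fI) fe fe' /=.
by apply: contra_neq => ->.
Qed.

Lemma exists_through_t_edge i j : j != i -> j < m -> m <= n.+1 ->
  exists2 f, f \in through through_t (X i) & Y i \notin codom f /\
    exists u w, [/\ adj u w, f u = X j & f w = X i].
Proof.
move=> ji jm mn; have [v [u [w [vw nvw vu uw]]]] := diameter2_cherry diamF.
have [vu' uw'] := (adj_neq vu, adj_neq uw).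
have Xji : (X j == X i) = false by apply: contraNF ji => /eqP [->].
pose p e := if e == v then t else if e == u then X j else X i.
have pv : p v = t by rewrite /p eqxx.
have pu : p u = X j by rewrite /p eq_sym (negPf vu') eqxx.
have pw : p w = X i by rewrite /p ![w == _]eq_sym (negPf vw) (negPf uw').
have [f] : exists f, f \in injective_extensions [set v; u; w] p (near_t i).
  apply/card_gt0P; apply: leq_trans (leq_card_injective_extensions _ _).
  - by rewrite ffact_gt0 leq_sub2r // leq_card_near_t.
  - by move=> e e'; rewrite !inE -!orbA => /or3P [] /eqP -> /or3P [] /eqP ->;
      rewrite ?pv ?pu ?pw // => /eqP; rewrite ?Xji // eq_sym Xji.
  - by move=> e; rewrite !inE -!orbA => /or3P [] /eqP ->;
      rewrite ?pv ?pu ?pw ?eqxx ?orbT //= jm !orbT.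
case/injective_extensionsP=> fp fI fK.
have fv : f v = t by rewrite fp ?pv // !inE eqxx.
have fu : f u = X j by rewrite fp ?pu // !inE eqxx orbT.
have fw : f w = X i by rewrite fp ?pw // !inE eqxx orbT.
have fE := embeddings_near_t nvw fI fv fw fK.
exists f; first by rewrite !in_through fE -fv -fw !codom_f.
split; last by exists u, w.
by apply/codomP => -[e fe]; have := fK e; rewrite -fe => /near_tP [].
Qed.

Lemma card_through_t_Y_lt_X i : 2 * m <= n ->
  #|through through_t (Y i)| < #|through through_t (X i)|.
Proof.
move=> mn; have m2 := diameter2_card diamF.
have n0 : 0 < n by lia.
have high_sum (a b : nat) : n.+1 < a + m -> n.+1 < b + m -> n < a + b by lia.
have [j [ji jm ij]] : exists j : 'I_n.+1, [/\ j != i, j < m & j + i <= n].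
  have [->|i0] := eqVneq i ord0; last first.
    by exists ord0; rewrite eq_sym i0 (ltnW (ltnW m2)) -ltnS ltn_ord.
  by exists (inord 1); rewrite -val_eqE /= inordK ?ltnS // addn0 n0 (ltnW m2).
have m_le_n : m <= n.+1 by lia.
have [f fP [yf [u [w [uw fu fw]]]]] := exists_through_t_edge ji jm m_le_n.
rewrite -addn1 -(cards1 f); apply: card_through_tperm => g.
  case/setIdP=> /setIdP [gP /codomP [e ge]] xg; have /setIdP [gE gt] := gP.
  have i_high := through_t_Y_high gP (esym ge).
  rewrite in_through mem_codom_tperm tpermD // gt andbT.
  have gx : g \in missing E (X i) by rewrite in_missing gE.
  apply: embeddings_tperm => // c; have := missing_neq gx c.
  case gc: (g c) => [[[] k]|] //=; last by move=> + _; apply: contra_neq => ->.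
  by move=> _ _; apply: high_sum i_high (through_t_Y_high gP gc).
move=> /set1P ->; case/setIdP: fP => fP xf; rewrite in_missing fP yf xf; split=> //.
rewrite in_through; apply/nandP; left; apply/negP => /embedding_adj /(_ uw).
rewrite !ffunE fu fw tpermR tpermD //=; last by apply: contra_neq ji => -[].
by rewrite ltnNge ij.
Qed.

(** * Irregularity *)

Section Irregularity.

Hypothesis n_large : 2 * m <= n.
Hypothesis n_large_X : m.+1 * (m ^ 3 * N ^ (m - 3)) < (n - 1) ^_ (m - 2).
Hypothesis n_large_t : m * (m ^ 2 * N ^ (m - 2)) < n ^_ (m - 1).

Local Notation count z := #|through E z|.

Lemma count_t_lt_Y0 : count t < count (Y ord0).
Proof.
rewrite [leqRHS](card_through_missing E t) card_avoiding_t_YX.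
apply: leq_trans (leq_addl _ _).
exact: leq_ltn_trans leq_card_through_t (leq_trans n_large_t leq_card_avoiding_t_X0).
Qed.

Lemma count_Y_lt_X i : count (Y i) < count (X i).
Proof.
rewrite [leqRHS](card_through_missing E t) (card_through_missing E t (Y i)).
by rewrite card_avoiding_t_YX ltn_add2r card_through_t_Y_lt_X.
Qed.

Lemma count_X_lt_Y_succ i i' : i' = i.+1 :> nat -> count (X i) < count (Y i').
Proof.
move=> i'E; rewrite [leqRHS](card_through_missing E t) card_avoiding_t_YX.
rewrite (card_through_missing E t (X i)).
have := card_avoiding_t_step i'E; have := leq_card_bridging i'E.
by have := leq_card_through_t_X i; have := n_large_X; lia.
Qed.

Lemma count_X_lt_Y i j : i < j -> count (X i) < count (Y j).
Proof.
have := ltn_ord j; rewrite -[in Y j](inord_val j).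
elim: (nat_of_ord j) => // k IH kn.
have step : count (X (inord k)) < count (Y (inord k.+1)).
  by apply: count_X_lt_Y_succ; rewrite !inordK // ltnW.
rewrite ltnS leq_eqVlt => /predU1P [ik|ik]; first by rewrite -[i]inord_val ik.
exact: ltn_trans (IH (ltnW kn) ik) (ltn_trans (count_Y_lt_X _) step).
Qed.

Lemma count_lt b c i j :
  i < j -> count (Some (b, i) : vert G) < count (Some (c, j) : vert G).
Proof.
move=> ij; apply: (@leq_ltn_trans (count (X i))).
  by case: b => //; apply/ltnW/count_Y_lt_X.
apply: leq_trans (count_X_lt_Y ij) _.
by case: c => //; apply/ltnW/count_Y_lt_X.
Qed.

Lemma count_t_lt b i : count t < count (Some (b, i) : vert G).
Proof.
apply: leq_trans count_t_lt_Y0 _; have [->|i0] := eqVneq i ord0; last first.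
  by apply/ltnW/count_lt; rewrite lt0n.
by case: b => //; apply/ltnW/count_Y_lt_X.
Qed.

Lemma tagged_half_graph_irregular : F_irregular F G.
Proof.
apply: F_irregular_embeddings => -[[b i]|] [[c j]|] //= /eqP; last first.
- by rewrite ltn_eqF ?count_t_lt.
- by rewrite gtn_eqF ?count_t_lt.
have [ij|ji|/val_inj ->] := ltngtP i j; first by rewrite ltn_eqF ?count_lt.
  by rewrite gtn_eqF ?count_lt.
have := count_Y_lt_X j.
by case: b c => [] [] // YX; rewrite ?(ltn_eqF YX) ?(gtn_eqF YX).
Qed.

End Irregularity.

Lemma tagged_half_graph_irregular_large q :
  n = q + m -> m.+1 ^ 4 * 5 ^ m < q -> F_irregular F G.
Proof.
move=> nE q_large; have m2 := diameter2_card diamF.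
have m_q : m < q.
  apply: ltn_trans (ltn_expl m (isT : 1 < 5)) (leq_ltn_trans _ q_large).
  by rewrite leq_pmull ?expn_gt0.
have leN : N <= 5 * q by rewrite card_tagged_half_graph; lia.
have small c r : c <= m.+1 ^ 4 -> r <= m -> c * 5 ^ r < q.
  by move=> cm rm; apply: leq_ltn_trans q_large; rewrite leq_mul ?leq_pexp2l.
have m34 : m ^ 3 <= m.+1 ^ 3 by rewrite leq_exp2r.
apply: tagged_half_graph_irregular; first by lia.
  rewrite mulnA -[m - 2](_ : (m - 3).+1 = _); last by lia.
  apply: mul_expn_lt_ffact leN (small _ _ _ _) _; [|lia|lia].
  by rewrite [m.+1 ^ 4]expnS leq_mul.
rewrite mulnA -expnS -[m - 1](_ : (m - 2).+1 = _); last by lia.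
apply: mul_expn_lt_ffact leN (small _ _ _ _) _; [|lia|lia].
by apply: leq_trans m34 _; rewrite leq_pexp2l.
Qed.

End Embeddings.

Theorem theorem4 (F : sgraph) :
  nontrivial F -> has_diameter F 2 ->
  exists G : nat -> sgraph,
    (forall n, nontrivial (G n) /\ has_diameter (G n) 3 /\ F_irregular F (G n)) /\
    (forall m n, m <> n -> ~ isomorphic (G m) (G n)).
Proof.
move=> _ diamF; set m := #|vert F|; have m2 : 2 < m := diameter2_card diamF.
pose order k := (m.+1 ^ 4 * 5 ^ m + k).+1 + m.
exists (fun k => tagged_half_graph m (order k)); split=> [k|k l kl].
  split; first by rewrite /nontrivial card_tagged_half_graph.
  split; last first.
    by apply: tagged_half_graph_irregular_large => //; rewrite ltnS leq_addr.
  by apply: tagged_half_graph_diameter; rewrite ?(ltnW m2) // /order addSn.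
by move=> /tagged_half_graph_iso; rewrite /order; lia.
Qed.
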